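(* Let $P_{18}=\{213,231,321\}$. For every $n\ge 1$, the number of perfect matchings on $[2n]$ that avoid $P_{18}$ is the Fuss--Catalan number $$|\mathcal{M}_n(P_{18})|=\frac{1}{3n+1}\binom{3n+1}{n}.$$
   Context: $[2n]=\{1,\dots,2n\}$. A perfect matching on $[2n]$ is a partition of $[2n]$ into $n$ pairs (arcs); for an arc $B$, $o(B)$ is its smaller (opening) and $c(B)$ its larger (closing) vertex. A matching contains a pattern $p=p_1p_2p_3\in\mathfrak{S}_3$ if it has three arcs $B_1,B_2,B_3$ with $o(B_1)<o(B_2)<o(B_3)$, with all three opening vertices smaller than all three closing vertices, and with $c(B_i)<c(B_j)\iff p_i>p_j$ for all $i,j\in\{1,2,3\}$. Thus, as matchings on $[6]$: $123$ is $\{(1,6),(2,5),(3,4)\}$, $132$ is $\{(1,6),(2,4),(3,5)\}$, $213$ is $\{(1,5),(2,6),(3,4)\}$, $231$ is $\{(1,5),(2,4),(3,6)\}$, $312$ is $\{(1,4),(2,6),(3,5)\}$, $321$ is $\{(1,4),(2,5),(3,6)\}$. A matching avoids a set $P$ of patterns if it contains none of them; $\mathcal{M}_n(P)$ is the set of perfect matchings on $[2n]$ avoiding $P$. *)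

(* Defs.v *)
From HB Require Import structures.
From mathcomp Require Import all_boot all_order all_algebra all_fingroup.

Set Implicit Arguments.
Unset Strict Implicit.
Unset Printing Implicit Defensive.

(* The vertices 1, ..., 2n are represented by the ordinals 0, ..., 2n - 1 of
   'I_(2 * n); only their order matters. *)

Definition perfect_matching (n : nat) (M : {set {set 'I_(2 * n)}}) : bool :=
  partition M [set: 'I_(2 * n)] && [forall B in M, #|B| == 2].

(* The default value 2n lies above every vertex, so that on a nonempty block
   this is the minimum. *)
Definition opening (n : nat) (B : {set 'I_(2 * n)}) : nat :=
  \big[minn/2 * n]_(v in B) (v : nat).

Definition closing (n : nat) (B : {set 'I_(2 * n)}) : nat :=
  \max_(v in B) (v : nat).

Definition contains (n : nat) (M : {set {set 'I_(2 * n)}}) (p : 'S_3) : bool :=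
  [exists B : {ffun 'I_3 -> {set 'I_(2 * n)}},
    [&& [forall i, B i \in M],
        [forall i : 'I_3, forall j : 'I_3,
          (i < j) ==> (opening (B i) < opening (B j))],
        [forall i, forall j, opening (B i) < closing (B j)]
      & [forall i, forall j,
          (closing (B i) < closing (B j)) == (p i > p j)]]].

Definition avoids (n : nat) (M : {set {set 'I_(2 * n)}}) (P : {set 'S_3}) :
    bool :=
  [forall p in P, ~~ contains M p].

Definition avoiding_matchings (n : nat) (P : {set 'S_3}) :
    {set {set {set 'I_(2 * n)}}} :=
  [set M | perfect_matching M & avoids M P].

(* One-line notation p_1 p_2 p_3, with values in {1, 2, 3}. *)
Definition one_line (p : 'S_3) : seq nat := [seq (p i).+1 | i <- enum 'I_3].

Definition P18 : {set 'S_3} :=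
  [set p | one_line p \in [:: [:: 2; 1; 3]; [:: 2; 3; 1]; [:: 3; 2; 1]]].

(* Main.v *)
Require Import Defs.
From mathcomp Require Import all_boot all_order all_algebra all_fingroup.
From mathcomp Require Import zify.

Set Implicit Arguments.
Unset Strict Implicit.
Unset Printing Implicit Defensive.

(** Read a matching from left to right. A pattern 213, 231 or 321 occurs exactly
    when some arc X closes first, among three arcs open at the same time, and
    the two others Y and Z, opened in this order, then close with Y before Z:
    these are the three patterns whose one-line notation has 2 before 1
    ([avoids_P18P]). So a matching avoids them exactly when, as soon as some
    arc closes, the arcs still open are committed to closing in last-in
    first-out order among themselves; arcs opened since the last closing are
    free. At a closing step the arc that closes may therefore be any of the free
    arcs or the latest committed arc, if there is one.

    To count, encode a matching by the word whose letter at a vertex is the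
    opening of the arc through that vertex. The rule above decides which letters
    may extend a prefix ([letters]), and the words built in this way are exactly
    those of the avoiding matchings ([card_avoiding_matchings]).

    The number of completions of a prefix depends only on the number h of open
    arcs, the number c of arcs allowed to close next, and the number e of arcs
    still to be opened. Opening an arc changes (h, c) to (h + 1, c + 1). Closing
    one changes h to h - 1 and leaves at most one arc allowed to close next,
    because everything still open is then committed. Let A = 1 + t A^3 be the
    generating function of ternary trees and R(e, r) the coefficient of t^e in
    A^r, so that R(e + 1, r + 1) = R(e + 1, r) + R(e, r + 3) ([raneyS]). Then
    (c - 1) R(e, 2h) + R(e, 2h + 1), where c - 1 is read as 0 if c = 0,
    satisfies the recurrence for the number of completions ([size_words]). The
    empty prefix gives R(n, 1), and the closed form
    (3e + r) R(e, r) = r binom(3e + r, e) ([raney_binomial]) concludes. *)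

(** * Powers of the generating function of ternary trees *)

(** The inner recursion, on the exponent, of the double recursion that defines
    [raney]: [row] holds the coefficients of the previous degree. *)
Fixpoint raney_row (row : nat -> nat) (r : nat) : nat :=
  if r is r'.+1 then raney_row row r' + row (r' + 3) else 0.

(** The coefficient of t^e in A^r, where A = 1 + t A^3. *)
Fixpoint raney (e r : nat) : nat :=
  if e is e'.+1 then raney_row (raney e') r else 1.

(** This is A^(r+1) = A^r + t A^(r+3). *)
Lemma raneyS e r : raney e.+1 r.+1 = raney e.+1 r + raney e (r + 3).
Proof. by []. Qed.

(** The Raney numbers. With M = 3e + r + 3, the induction step adds the closed
    forms of the two terms of [raneyS], whose denominators are both M; it comes
    down to Pascal's rule and to (e+1) binom(M, e+1) = (M-e) binom(M, e). *)
Lemma raney_binomial e r : (3 * e + r) * raney e r = r * 'C(3 * e + r, e).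
Proof.
elim: e r => [|e IHe] r; first by rewrite bin0.
elim: r => [|r IHr]; first by rewrite muln0.
have {}IHe := IHe (r + 3); rewrite raneyS.
have [M defM] : exists M, M = 3 * e + r + 3 by eexists.
have E1 : 3 * e.+1 + r = M by lia.
have E2 : 3 * e.+1 + r.+1 = M.+1 by lia.
have E3 : 3 * e + (r + 3) = M by lia.
move: IHr IHe; rewrite E1 E2 E3 binS => IHr IHe.
have absorb : e.+1 * 'C(M, e.+1) = (M - e) * 'C(M, e).
  by rewrite mul_bin_left.
have M_gt0 : 0 < M by lia.
apply/eqP; rewrite -(eqn_pmul2l M_gt0) mulnCA mulnDr IHr IHe; apply/eqP.
move: absorb; move: 'C(M, e.+1) 'C(M, e) => a b; rewrite defM.
have -> : 3 * e + r + 3 - e = 2 * e + r + 3 by lia.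
nia.
Qed.

(** * Prefixes of words and their completions *)

(** In a prefix [u] of the word of a matching, the letter at position [q] is the
    opening of the arc through [q]: an opening [v] appears first at position
    [v], and a second time when its arc closes. So the letters seen once are
    the arcs still open. *)
Definition opens (u : seq nat) : seq nat :=
  [seq v <- iota 0 (size u) | count_mem v u == 1].

(** A letter smaller than its position [p] says that an arc closes at [p]; the
    arcs opened before [p] and still open are then committed. *)
Definition committed (u : seq nat) (z : nat) : bool :=
  has (fun p => (nth 0 u p < p) && (z < p)) (iota 0 (size u)).

(** An open arc may close when it comes after all the other committed open arcs:
    it is the latest committed arc, or it is free. *)
Definition pops (u : seq nat) : seq nat :=
  [seq x <- opens u | all (fun z => committed u z ==> (z <= x)) (opens u)].

Definition letters (u : seq nat) : seq nat := size u :: pops u.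

(** The whole prefix serves as the state, rather than its lists of open and
    committed arcs: membership then becomes a separate condition on each letter
    ([mem_words]). *)
Fixpoint words (N : nat) (u : seq nat) : seq (seq nat) :=
  if N is N'.+1 then flatten [seq words N' (rcons u x) | x <- letters u]
  else if opens u is [::] then [:: u] else [::].

(** If the marked elements are the smallest ones, those that are at least as
    large as every marked one are the unmarked elements and the largest marked
    one. *)
Lemma size_filter_above_marked (a : pred nat) (s : seq nat) :
  sorted ltn s -> {in s &, forall y z, y < z -> a z -> a y} ->
  size [seq x <- s | all (fun z => a z ==> (z <= x)) s] =
    count (predC a) s + (0 < count a s).
Proof.
elim/last_ind: s => [|s y IHs] // s_sorted a_down.
have s_lt : all (gtn y) s.
  move: s_sorted; rewrite -cats1 sorted_pairwise; last exact: ltn_trans.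
  by rewrite pairwise_cat allrel1r => /andP[].
have {}s_sorted : sorted ltn s.
  by move: s_sorted; rewrite -cats1 => /cat_sorted2[].
rewrite -!cats1 !count_cat filter_cat size_cat /= all_cat /=.
rewrite leqnn implybT !addn0.
have -> : all (fun z => a z ==> (z <= y)) s.
  by apply/allP=> z /(allP s_lt) /= /ltnW ->; rewrite implybT.
have [ay|nay] /= := boolP (a y).
  have as_ : all a s.
    apply/allP=> z zs; apply: a_down (allP s_lt z zs) ay;
      by rewrite mem_rcons inE ?zs ?orbT ?eqxx.
  have -> : count (predC a) s = 0.
    by apply/eqP; rewrite -leqn0 leqNgt -has_count has_predC as_.
  rewrite (eq_in_filter (a2 := pred0)) ?filter_pred0 => [|x xs /=].
    by move=> /=; lia.
  by rewrite all_cat /= ay (ltn_geF (allP s_lt x xs)) andbF.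
have -> : [seq x <- s | all (fun z => a z ==> (z <= x)) (s ++ [:: y])] =
          [seq x <- s | all (fun z => a z ==> (z <= x)) s].
  by apply: eq_filter => x; rewrite all_cat /= (negbTE nay) !andbT.
rewrite IHs //; first by rewrite addn0 addnAC addn1.
by move=> u v us vs; apply: a_down; rewrite mem_rcons inE ?us ?vs orbT.
Qed.

Lemma opens_sorted u : sorted ltn (opens u).
Proof. by apply: sorted_filter (iota_ltn_sorted _ _); apply: ltn_trans. Qed.

Lemma opens_uniq u : uniq (opens u).
Proof. by rewrite filter_uniq ?iota_uniq. Qed.

Lemma mem_opens u v : (v \in opens u) = (v < size u) && (count_mem v u == 1).
Proof. by rewrite mem_filter mem_iota andbC. Qed.

Lemma mem_pops u x : x \in pops u -> x \in opens u.
Proof. by rewrite mem_filter => /andP[]. Qed.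

Lemma size_pops u :
  size (pops u) =
    count (predC (committed u)) (opens u) + (0 < count (committed u) (opens u)).
Proof.
apply: size_filter_above_marked (opens_sorted u) _ => y z _ _ lt_yz.
move=> /hasP[p p_u /andP[p_close z_p]]; apply/hasP; exists p => //.
by rewrite p_close (ltn_trans lt_yz).
Qed.

(* The letters of a prefix are openings of vertices already read. This is the
   only property of [u] that the effect of one more letter depends on. *)
Section Step.
Variable u : seq nat.
Hypothesis u_lt : all (gtn (size u)) u.

Lemma notin_size : size u \notin u.
Proof. by apply/negP=> /(allP u_lt); rewrite /= ltnn. Qed.

Lemma opens_push : opens (rcons u (size u)) = rcons (opens u) (size u).
Proof.
rewrite /opens size_rcons -[(size u).+1]addn1 iotaD filter_cat add0n /=.
rewrite -!cats1 count_cat /= (count_memPn notin_size) eqxx /=; congr (_ ++ _).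
apply: eq_in_filter => v; rewrite mem_iota /= add0n => v_lt.
by rewrite count_cat /= (gtn_eqF v_lt) !addn0.
Qed.

Lemma opens_pop x : x \in opens u -> opens (rcons u x) = rem x (opens u).
Proof.
move=> x_op; have := x_op; rewrite mem_opens => /andP[x_lt /eqP x1].
rewrite rem_filter ?opens_uniq // /opens size_rcons -[(size u).+1]addn1 iotaD.
rewrite filter_cat add0n /= -cats1 count_cat /= (count_memPn notin_size).
rewrite (ltn_eqF x_lt) /= cats0.
rewrite -filter_predI; apply: eq_in_filter => v _ /=.
rewrite count_cat /= addn0 (eq_sym x).
by case: (eqVneq v x) => [->|_]; rewrite ?x1 ?addn0.
Qed.

Lemma committed_push z : committed (rcons u (size u)) z = committed u z.
Proof.
rewrite /committed size_rcons -[(size u).+1]addn1 iotaD has_cat /= add0n.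
rewrite nth_rcons ltnn eqxx ltnn /= orbF; apply: eq_in_has => p.
rewrite mem_iota /= add0n => p_lt.
by rewrite nth_rcons p_lt.
Qed.

Lemma committed_pop x z :
  x < size u -> z < size u -> committed (rcons u x) z.
Proof.
move=> x_lt z_lt; apply/hasP; exists (size u).
  by rewrite mem_iota size_rcons /= add0n.
by rewrite nth_rcons ltnn eqxx x_lt.
Qed.

Lemma letters_bound x :
  x \in letters u -> all (gtn (size (rcons u x))) (rcons u x).
Proof.
rewrite inE => x_le; have {}x_le : x <= size u.
  by case/orP: x_le => [/eqP->//|/mem_pops]; rewrite mem_opens => /andP[/ltnW].
rewrite all_rcons size_rcons /= ltnS x_le; apply: sub_all u_lt => y.
exact: ltnW.
Qed.

(** The new arc is free, and no arc changes status. *)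
Lemma size_pops_push : size (pops (rcons u (size u))) = (size (pops u)).+1.
Proof.
have not_com : committed u (size u) = false.
  apply/hasPn=> p; rewrite mem_iota /= add0n => p_lt.
  by rewrite (leq_gtF (ltnW p_lt)) andbF.
rewrite !size_pops opens_push.
have -> : count (predC (committed (rcons u (size u)))) =1
          count (predC (committed u)).
  by apply: eq_count => z /=; rewrite committed_push.
have -> : count (committed (rcons u (size u))) =1 count (committed u).
  exact: eq_count committed_push.
by rewrite -cats1 !count_cat /= not_com /= !addn0 addn1.
Qed.

(** After a closing every open arc is committed, so at most one of them, the
    latest, may close next. *)
Lemma size_pops_pop x :
  x \in opens u -> (size (pops (rcons u x))).-1 = 0.
Proof.
move=> x_op; rewrite size_pops.
have -> : count (predC (committed (rcons u x))) (opens (rcons u x)) = 0.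
  apply/eqP; rewrite -leqn0 leqNgt -has_count; apply/hasPn => z /=.
  rewrite opens_pop // => /mem_rem; rewrite !mem_opens => /andP[z_lt _].
  move: x_op; rewrite mem_opens => /andP[x_lt _].
  by rewrite negbK committed_pop.
by case: (0 < _).
Qed.

Lemma size_opens_pop x :
  x \in opens u -> size (opens (rcons u x)) = (size (opens u)).-1.
Proof. by move=> x_op; rewrite opens_pop // size_rem. Qed.

End Step.

(** Each remaining vertex closes at most one arc. *)
Lemma words_too_short N u :
  all (gtn (size u)) u -> N < size (opens u) -> words N u = [::].
Proof.
elim: N u => [|N IHN] u u_lt; first by rewrite /=; case: (opens u).
move=> lt_N; apply/nilP; rewrite /nilp /= size_cat addn_eq0.
rewrite IHN ?letters_bound ?inE ?eqxx //=; last first.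
  by rewrite opens_push // size_rcons; lia.
rewrite size_flatten /shape -map_comp sumnE big_map big1_seq // => x /= x_pop.
have x_op := mem_pops x_pop.
rewrite IHN ?letters_bound ?inE ?x_pop ?orbT // size_opens_pop //; lia.
Qed.

(** Here [e] is the number of arcs still to be opened. Write h and c for the
    sizes of [opens u] and [pops u], F(e, h, c) for the right-hand side, and R
    for [raney]. Pushing gives F(e-1, h+1, c+1), and each of the c pops gives
    R(e, 2h-1), because the coefficient of R(e, 2h-2) vanishes. The sum of
    these is F(e, h, c) by two uses of [raneyS]. *)
Lemma size_words e u : all (gtn (size u)) u ->
  size (words (2 * e + size (opens u)) u) =
    (size (pops u)).-1 * raney e (2 * size (opens u))
    + raney e (2 * size (opens u)).+1.
Proof.
have [N] := ubnP (2 * e + size (opens u)).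
elim: N e u => // N IHN e u lt_N u_lt.
have pops_gt0 : (0 < size (opens u)) = (0 < size (pops u)).
  rewrite size_pops -(count_predC (committed u)); lia.
have push_in : size u \in letters u by rewrite inE eqxx.
case defN : (2 * e + size (opens u)) => [|N'] /=.
  have -> : e = 0 by lia.
  have /size0nil op0 : size (opens u) = 0 by lia.
  by rewrite /pops op0.
rewrite size_cat size_flatten /shape -map_comp sumnE big_map.
have -> : \sum_(x <- pops u) (size \o (fun x => words N' (rcons u x))) x =
          size (pops u) * raney e (2 * size (opens u)).-1.
  rewrite big_seq (eq_bigr (fun _ => raney e (2 * size (opens u)).-1)).
    by rewrite -big_seq big_const_seq count_predT iter_addn_0 mulnC.
  move=> x x_pop /=; have x_op := mem_pops x_pop.
  have x_let : x \in letters u by rewrite inE x_pop orbT.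
  have op_gt0 : 0 < size (opens u) by case: (opens u) x_op.
  have -> : N' = 2 * e + size (opens (rcons u x)).
    by rewrite size_opens_pop //; lia.
  rewrite IHN ?letters_bound // ?size_pops_pop // ?size_opens_pop //; last lia.
  by rewrite mul0n add0n; congr (raney _ _); lia.
(* When no arc is left to be opened, pushing leads nowhere. *)
case: e lt_N defN => [|e] lt_N defN.
  rewrite words_too_short ?letters_bound // ?opens_push ?size_rcons //=; lia.
have -> : N' = 2 * e + size (opens (rcons u (size u))).
  by rewrite opens_push // size_rcons; lia.
rewrite IHN ?letters_bound ?size_pops_push // ?opens_push ?size_rcons //;
  last lia.
move: pops_gt0; case: (size (opens u)) => [|h] pops_gt0.
  have -> : size (pops u) = 0 by lia.
  by rewrite muln0 (raneyS e 0) !mul0n !addn0 !add0n.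
have [c ->] : exists c, size (pops u) = c.+1.
  by exists (size (pops u)).-1; lia.
have -> : 2 * h.+1 = (2 * h).+2 by lia.
have -> : 2 * h.+2 = (2 * h).+4 by lia.
by rewrite !PeanoNat.Nat.pred_succ !raneyS !addn3; lia.
Qed.

(** * The words of avoiding matchings *)

Lemma wordsS N u :
  words N.+1 u = flatten [seq words N (rcons u x) | x <- letters u].
Proof. by []. Qed.

(** Legality of each letter depends only on what precedes it, so completions can
    be recognised letter by letter. *)
Lemma mem_words N u w :
  (w \in words N u) =
  [&& size w == size u + N, take (size u) w == u,
      all (fun q => nth 0 w q \in letters (take q w)) (iota (size u) N)
    & nilp (opens w)].
Proof.
elim: N u => [|N IHN] u.
  rewrite addn0 /= /nilp; apply/idP/and3P => [|[/eqP szw /eqP <- op0]].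
    case op_u: (opens u) => [|//]; rewrite inE => /eqP ->.
    by rewrite take_size !eqxx op_u.
  by rewrite -szw take_size (size0nil (eqP op0)) inE.
rewrite wordsS; apply/flatten_mapP/and4P.
  case=> x x_u; rewrite IHN => /and4P[/eqP szw /eqP takew lets op0].
  rewrite size_rcons in szw takew lets.
  have lt_w : size u < size w by lia.
  move: takew; rewrite (take_nth 0) // => /rcons_inj[takew nthw].
  split; rewrite ?takew //= ?takew ?nthw ?x_u //.
  by rewrite szw addnS.
case=> /eqP szw /eqP takew /andP[let_x lets] op0.
exists (nth 0 w (size u)); first by rewrite -{2}takew.
rewrite IHN size_rcons; apply/and4P; split=> //; first by rewrite szw addnS.
by rewrite -{2}takew -take_nth // szw; lia.
Qed.

Lemma letters_uniq u : uniq (letters u).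
Proof.
rewrite /= filter_uniq ?opens_uniq // andbT.
by apply/negP=> /mem_pops; rewrite mem_opens ltnn.
Qed.

Lemma words_uniq N u : uniq (words N u).
Proof.
elim: N u => [|N IHN] u; first by rewrite /=; case: (opens u).
have nthx x w : w \in words N (rcons u x) -> nth 0 w (size u) = x.
  rewrite mem_words => /and4P[_ /eqP takew _ _].
  rewrite -(@nth_take (size u).+1) // -(size_rcons u x) takew.
  by rewrite nth_rcons ltnn eqxx.
rewrite wordsS; elim: (letters u) (letters_uniq u) => //= x s IHs.
case/andP=> xs s_uniq; rewrite cat_uniq IHN IHs // andbT.
apply/hasPn=> w /flatten_mapP[y ys /nthx w_y]; apply/negP => /nthx w_x.
by rewrite -w_x w_y ys in xs.
Qed.

(** The words that send each vertex to the smaller end of its arc. *)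
Definition matching_word (w : seq nat) : Prop :=
  {in gtn (size w), forall q, nth 0 w q <= q} /\
  {in w, forall v, nth 0 w v = v /\ count_mem v w = 2}.

(** The vertices [p < q < r] are closings of three arcs, the last two opened in
    the order in which they close; these three arcs would form a forbidden
    pattern if the third one were opened before [p]. That [q] and [r] are
    closings is automatic in that case: their letters are then less than [p]. *)
Definition avoiding_word (w : seq nat) : Prop :=
  forall p q r, p < q < r -> r < size w ->
    nth 0 w p < p -> nth 0 w q < nth 0 w r -> p <= nth 0 w r.

Lemma count_take_open (w : seq nat) (v q r : nat) :
  count_mem v w = 2 -> nth 0 w v = v -> nth 0 w r = v ->
  v < q <= r -> r < size w -> count_mem v (take q w) = 1.
Proof.
move=> v2 nthv nthr /andP[lt_vq le_qr] lt_r.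
have: 0 < count_mem v (take q w).
  rewrite -has_count has_pred1; apply/(nthP 0); exists v.
    by rewrite size_takel // (leq_trans le_qr) // ltnW.
  by rewrite nth_take.
have: 0 < count_mem v (drop q w).
  rewrite -has_count has_pred1; apply/(nthP 0); exists (r - q).
    by rewrite size_drop ltn_sub2r // (leq_ltn_trans le_qr).
  by rewrite nth_drop subnKC.
by move: v2; rewrite -{1}(cat_take_drop q w) count_cat; lia.
Qed.

(** A letter [x] at [q] that is not legal has an open committed [z > x]. The arc
    of [z] closes later, at [q + r], and a closing [p] that commits [z] gives
    the forbidden configuration of closings [p < q < q + r]. *)
Lemma letters_of_matching (w : seq nat) :
  matching_word w -> avoiding_word w ->
  {in gtn (size w), forall q, nth 0 w q \in letters (take q w)} /\
  nilp (opens w).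
Proof.
move=> [w_le w_in] w_av; split=> [q lt_q|]; last first.
  rewrite /nilp -leqn0 leqNgt -has_predT; apply/hasPn=> v; rewrite mem_opens.
  case/andP=> _ /eqP v1; have [|_] := w_in v; last by rewrite v1.
  by rewrite -has_pred1 has_count v1.
have sz_take : size (take q w) = q by rewrite size_takel // ltnW.
have [nthx x2] := w_in _ (mem_nth 0 lt_q).
rewrite inE sz_take; case: ltngtP (w_le q lt_q) => //= lt_xq _.
rewrite mem_filter mem_opens sz_take lt_xq.
rewrite (count_take_open x2 nthx (erefl _)) ?lt_xq ?leqnn //= andbT.
apply/allP=> z; rewrite mem_opens sz_take => /andP[lt_zq /eqP z1].
apply/implyP=> /hasP[p]; rewrite mem_iota sz_take /= add0n => lt_pq.
rewrite nth_take // => /andP[w_p lt_zp]; rewrite leqNgt; apply/negP=> lt_xz.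
have zw : z \in w.
  by apply: (@mem_take q); rewrite -has_pred1 has_count z1.
have [_] := w_in z zw; rewrite -{1}(cat_take_drop q w) count_cat z1 => z_drop.
have /(nthP 0)[r] : z \in drop q w.
  by rewrite -has_pred1 has_count; lia.
rewrite size_drop nth_drop => lt_r w_r.
have r_gt0 : 0 < r.
  case: r w_r {lt_r} => // w_q; rewrite addn0 in w_q.
  by rewrite w_q ltnn in lt_xz.
have lt_qr : p < q < q + r by lia.
rewrite ltn_subRL in lt_r.
have := w_av p q (q + r) lt_qr lt_r w_p.
by rewrite w_r => /(_ lt_xz); rewrite leqNgt lt_zp.
Qed.

(** Legal letters keep every opening to at most two occurrences, and the absence
    of open arcs at the end excludes exactly one. In a forbidden configuration
    [p < q < r], the letter of [r] is an arc open and committed at [q], and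
    larger than the letter of [q], which is therefore not legal. *)
Lemma matching_of_letters (w : seq nat) :
  {in gtn (size w), forall q, nth 0 w q \in letters (take q w)} ->
  nilp (opens w) -> matching_word w /\ avoiding_word w.
Proof.
move=> w_let op0.
have sz_take q : q < size w -> size (take q w) = q.
  by move=> lt_q; rewrite size_takel // ltnW.
have w_le : {in gtn (size w), forall q, nth 0 w q <= q}.
  move=> q lt_q; have := w_let q lt_q; rewrite inE => /orP[/eqP->|/mem_pops].
    by rewrite sz_take.
  by rewrite mem_opens sz_take // => /andP[/ltnW].
have w_fix q : q < size w -> nth 0 w (nth 0 w q) = nth 0 w q.
  elim/ltn_ind: q => q IHq lt_q; have := w_let q lt_q.
  rewrite inE sz_take // => /orP[/eqP e|/mem_pops]; first by rewrite !e.
  rewrite mem_opens sz_take // => /andP[_ /eqP c1].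
  have /(nthP 0)[p] : nth 0 w q \in take q w by rewrite -has_pred1 has_count c1.
  rewrite sz_take // => lt_pq; rewrite nth_take // => <-.
  by apply: IHq => //; apply: ltn_trans lt_q.
have count_le v q : q <= size w -> count_mem v (take q w) <= 2.
  elim: q => [|q IHq] lt_q; first by rewrite take0.
  rewrite (take_nth 0) // -cats1 count_cat /= addn0.
  have [w_q|_] := eqVneq (nth 0 w q) v; last by rewrite addn0 IHq // ltnW.
  rewrite addn1 ltnS; have := w_let q lt_q; rewrite w_q inE sz_take //.
  case/orP=> [/eqP v_q|/mem_pops]; last by rewrite mem_opens => /andP[_ /eqP->].
  rewrite leqW // leqn0 -leqn0 leqNgt -has_count has_pred1 v_q.
  apply/negP=> /(nthP 0)[p]; rewrite sz_take // => lt_pq.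
  rewrite nth_take // => w_p.
  by have := w_le p (ltn_trans lt_pq lt_q); rewrite w_p leqNgt lt_pq.
have w_in : {in w, forall v, nth 0 w v = v /\ count_mem v w = 2}.
  move=> v vw; have /(nthP 0)[q lt_q w_q] := vw.
  split; first by rewrite -w_q w_fix.
  have := count_le v _ (leqnn (size w)); rewrite take_size.
  have : 0 < count_mem v w by rewrite -has_count has_pred1.
  have : count_mem v w != 1.
    have := w_le q lt_q; rewrite w_q => le_vq.
    have := mem_opens w v; rewrite (size0nil (eqP op0)).
    rewrite (leq_ltn_trans le_vq) //.
    by rewrite in_nil /= => <-.
  by lia.
split; first by [].
move=> p q r /andP[lt_pq lt_qr] lt_r w_p lt_w.
rewrite leqNgt; apply/negP=> lt_rp.
have lt_q := ltn_trans lt_qr lt_r.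
have [z_fix z2] := w_in _ (mem_nth 0 lt_r).
have := w_let q lt_q; rewrite inE sz_take // ltn_eqF /=; last lia.
rewrite mem_filter => /andP[/allP/(_ (nth 0 w r))]; rewrite leqNgt lt_w implybF.
move=> no_com _; suff: ~~ committed (take q w) (nth 0 w r).
  case/hasP; exists p; first by rewrite mem_iota sz_take.
  by rewrite nth_take // w_p lt_rp.
apply: no_com; rewrite mem_opens sz_take // (ltn_trans lt_rp) //=.
apply/eqP/(count_take_open z2 z_fix (erefl _)) => //.
by rewrite (ltn_trans lt_rp) // ltnW.
Qed.

Lemma avoiding_matching_words N w :
  w \in words N [::] <->
  [/\ size w = N, matching_word w & avoiding_word w].
Proof.
rewrite mem_words /= add0n take0 eqxx /=; split.
  case/and3P=> /eqP szw /allP lets op0.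
  have [q lt_q|w_m w_av] := @matching_of_letters w _ op0; last by split.
  by apply: lets; rewrite mem_iota -szw.
case=> szw w_m w_av; have [lets ->] := letters_of_matching w_m w_av.
rewrite szw eqxx andbT; apply/allP=> q; rewrite mem_iota -szw; exact: lets.
Qed.

Lemma size_words_start n :
  (3 * n + 1) * size (words (2 * n) [::]) = 'C(3 * n + 1, n).
Proof.
have := @size_words n [::] isT.
by rewrite muln0 addn0 mul0n add0n => ->; rewrite raney_binomial mul1n.
Qed.

(** * Perfect matchings and their words *)

Section Matchings.
Variable n : nat.
Implicit Types (B C : {set 'I_(2 * n)}) (M : {set {set 'I_(2 * n)}}).

Lemma opening_le B (v : 'I_(2 * n)) : v \in B -> opening B <= v.
Proof.
move=> vB; rewrite /opening; have := mem_index_enum v.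
elim: (index_enum _) => //= u s IHs; rewrite inE big_cons.
case/orP=> [/eqP <-|/IHs le_v]; first by rewrite vB geq_minl.
by case: ifP => // _; apply: leq_trans (geq_minr _ _) le_v.
Qed.

Lemma opening_mem B :
  B != set0 -> exists2 v : 'I_(2 * n), v \in B & opening B = v.
Proof.
case/set0Pn=> u uB; have [o2n|//] : opening B = 2 * n \/
    exists2 v : 'I_(2 * n), v \in B & opening B = v.
  rewrite /opening; apply: (big_ind (fun x => x = 2 * n \/
    exists2 v : 'I_(2 * n), v \in B & x = v)) => [|x y|v vB]; first by left.
    by rewrite /minn; case: ifP.
  by right; exists v.
by have := opening_le uB; rewrite o2n leqNgt ltn_ord.
Qed.

Lemma arc_shape B : #|B| == 2 -> exists a b : 'I_(2 * n),
  [/\ B = [set a; b], a < b, opening B = a & closing B = b].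
Proof.
case/cards2P=> x [y [neq_xy defB]].
wlog lt_xy : x y neq_xy defB / x < y.
  move=> Hw; case: (ltngtP x y) => [lt|lt|/val_inj e]; first exact: (Hw x y).
    by apply: (Hw y x) => //; [rewrite eq_sym | rewrite setUC].
  by rewrite e eqxx in neq_xy.
have xB : x \in B by rewrite defB !inE eqxx.
have yB : y \in B by rewrite defB !inE eqxx orbT.
exists x, y; split=> //.
  have [|v vB o_v] := @opening_mem B; first by apply/set0Pn; exists x.
  apply/eqP; rewrite eqn_leq (opening_le xB) o_v /=.
  by move: vB; rewrite defB !inE => /orP[/eqP->//|/eqP->]; apply: ltnW.
apply/eqP; rewrite eqn_leq (bigmax_sup y) // andbT; apply/bigmax_leqP => v.
by rewrite defB !inE => /orP[/eqP->|/eqP->//]; apply: ltnW.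
Qed.

Definition word_of M : seq nat :=
  [seq opening (pblock M i) | i <- enum 'I_(2 * n)].

Lemma size_word_of M : size (word_of M) = 2 * n.
Proof. by rewrite size_map size_enum_ord. Qed.

Lemma nth_word_of M (i : 'I_(2 * n)) :
  nth 0 (word_of M) i = opening (pblock M i).
Proof. by rewrite (nth_map i) ?size_enum_ord // nth_ord_enum. Qed.

Section PerfectMatching.
Variable M : {set {set 'I_(2 * n)}}.
Hypothesis M_pm : perfect_matching M.

Let M_part : partition M [set: 'I_(2 * n)].
Proof. by case/andP: M_pm. Qed.

Let M_triv : trivIset M. Proof. by case/and3P: M_part. Qed.

Lemma block_card B : B \in M -> #|B| == 2.
Proof. by move: M_pm => /andP[_ /forallP/(_ B)/implyP]. Qed.

Lemma mem_block i : i \in pblock M i.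
Proof. by rewrite mem_pblock (cover_partition M_part) inE. Qed.

Lemma block_mem i : pblock M i \in M.
Proof. by rewrite pblock_mem // (cover_partition M_part) inE. Qed.

Lemma opening_inj : {in M &, injective (@opening n)}.
Proof.
move=> B C BM CM eq_o.
have [a [b [defB _ oB _]]] := arc_shape (block_card BM).
have [c [d [defC _ oC _]]] := arc_shape (block_card CM).
have aB : a \in B by rewrite defB !inE eqxx.
have aC : a \in C.
  rewrite defC !inE (_ : a = c) ?eqxx //.
  by apply: val_inj; rewrite /= -oB eq_o.
by rewrite -(def_pblock M_triv BM aB) (def_pblock M_triv CM aC).
Qed.

Lemma closer_of_block (i : 'I_(2 * n)) :
  opening (pblock M i) < i -> closing (pblock M i) = i.
Proof.
have [a [b [defB lt_ab -> ->]]] := arc_shape (block_card (block_mem i)).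
have := mem_block i; rewrite defB !inE => /orP[]/eqP-> //.
by rewrite ltnn.
Qed.

Lemma nth_word_of_closing B :
  B \in M -> nth 0 (word_of M) (closing B) = opening B.
Proof.
move=> BM; have [a [b [defB lt_ab _ cB]]] := arc_shape (block_card BM).
rewrite cB nth_word_of (def_pblock M_triv BM) //.
by rewrite defB !inE eqxx orbT.
Qed.

Lemma closing_lt B : B \in M -> closing B < 2 * n.
Proof. by move=> BM; have [a [b [_ _ _ ->]]] := arc_shape (block_card BM). Qed.

Lemma opening_lt_closing B : B \in M -> opening B < closing B.
Proof. by move=> BM; have [a [b [_ ? -> ->]]] := arc_shape (block_card BM). Qed.

Lemma matching_word_of : matching_word (word_of M).
Proof.
split=> [q|v].
  rewrite inE size_word_of => lt_q; rewrite (nth_word_of M (Ordinal lt_q)).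
  exact: opening_le (mem_block _).
case/mapP=> i _ ->; set B := pblock M i.
have BM : B \in M := block_mem i.
have [a [b [defB lt_ab oB _]]] := arc_shape (block_card BM).
have aB : a \in B by rewrite defB !inE eqxx.
split; first by rewrite {1}oB nth_word_of (def_pblock M_triv BM aB).
rewrite count_map; apply: etrans (eqP (block_card BM)).
rewrite cardE -size_filter enumT /enum_mem; congr size.
apply: eq_filter => j /=.
apply/eqP/idP => [/opening_inj <- //|jB]; rewrite ?block_mem ?mem_block //.
by rewrite (def_pblock M_triv BM jB).
Qed.

(** The arcs are the fibres of the word, so the word determines the matching. *)
Lemma preim_word_of :
  preim_partition (fun i : 'I_(2 * n) => nth 0 (word_of M) i) setT = M.
Proof.
rewrite -[RHS](preim_partition_pblock M_part); apply: eq_in_imset => i _.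
apply/setP=> j; rewrite !inE !nth_word_of; apply/eqP/eqP => [|-> //].
by apply: opening_inj; apply: block_mem.
Qed.

(** The common form of the patterns 213, 231 and 321: [X], [Y], [Z] are listed
    by closing, and the opening of [X] is left unconstrained. *)
Definition bad_triple (X Y Z : {set 'I_(2 * n)}) : Prop :=
  [/\ X \in M, Y \in M & Z \in M] /\
  [/\ closing X < closing Y, closing Y < closing Z, opening Y < opening Z
    & opening Z < closing X].

Lemma avoiding_word_of :
  avoiding_word (word_of M) <-> forall X Y Z, ~ bad_triple X Y Z.
Proof.
split=> [w_av X Y Z [[XM YM ZM] [lt_XY lt_YZ lt_o lt_oc]]|no_bad].
  have := w_av (closing X) (closing Y) (closing Z).
  rewrite lt_XY lt_YZ size_word_of closing_lt // !nth_word_of_closing //.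
  by rewrite opening_lt_closing // lt_o leqNgt lt_oc => /(_ isT isT isT isT).
move=> p q r /andP[lt_pq lt_qr]; rewrite size_word_of => lt_r.
have lt_q := ltn_trans lt_qr lt_r; have lt_p := ltn_trans lt_pq lt_q.
rewrite (nth_word_of M (Ordinal lt_p)) (nth_word_of M (Ordinal lt_q)).
rewrite (nth_word_of M (Ordinal lt_r)) => lt_op lt_o; rewrite leqNgt.
apply/negP=> lt_oc; pose Bl i := pblock M (Ordinal i).
have c_p := closer_of_block lt_op.
have c_r : closing (Bl r lt_r) = r.
  apply: closer_of_block.
  by rewrite (ltn_trans lt_oc) // (ltn_trans lt_pq).
have c_q : closing (Bl q lt_q) = q.
  by apply: closer_of_block; rewrite (ltn_trans lt_o) // (ltn_trans lt_oc).
apply: (no_bad (Bl p lt_p) (Bl q lt_q) (Bl r lt_r)); split.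
  by rewrite !block_mem.
by rewrite c_p c_q c_r; split.
Qed.

End PerfectMatching.

(** The matching is the partition of the vertices into the fibres of [w]: each
    letter occurs twice, so the fibres are pairs, and it occurs first at its own
    position, so it is the opening of its fibre. *)
Lemma matching_of_word (w : seq nat) :
  size w = 2 * n -> matching_word w ->
  exists2 M, perfect_matching M & word_of M = w.
Proof.
move=> sz_w [w_le w_in].
have lt_w (i : 'I_(2 * n)) : i < size w by rewrite sz_w.
pose f (i : 'I_(2 * n)) := nth 0 w i; pose M := preim_partition f setT.
have M_part : partition M setT by exact: preim_partitionP.
have in_block i j : (j \in pblock M i) = (f i == f j).
  by apply: pblock_equivalence_partition; rewrite ?inE // => x y z _ _ _;
    split=> // /eqP->.
have M_pm : perfect_matching M.
  rewrite /perfect_matching M_part; apply/forall_inP => B /imsetP[i _ ->].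
  have [_] := w_in (f i) (mem_nth 0 (lt_w i)).
  have {1}-> : w = [seq f j | j <- enum 'I_(2 * n)].
    apply: (@eq_from_nth _ 0) => [|k]; first by rewrite size_map size_enum_ord.
    rewrite sz_w => lt_k.
    by rewrite (nth_map (Ordinal lt_k)) ?size_enum_ord // /f nth_enum_ord.
  rewrite count_map -size_filter enumT => f2; apply/eqP; apply: etrans f2.
  rewrite cardE /enum_mem; congr size; apply: eq_filter => j /=.
  by rewrite !inE eq_sym.
exists M => //; apply: (@eq_from_nth _ 0); rewrite size_word_of // => k lt_k.
rewrite (nth_word_of M (Ordinal lt_k)); set i := Ordinal lt_k.
have lt_f : f i < 2 * n.
  by apply: leq_ltn_trans (ltn_ord i); apply: w_le; rewrite inE sz_w.
have [f_fix _] := w_in (f i) (mem_nth 0 (lt_w i)).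
apply/eqP; rewrite eqn_leq; apply/andP; split.
  by apply: (opening_le (v := Ordinal lt_f)); rewrite in_block /f /= f_fix.
have [|v] := @opening_mem (pblock M i).
  by apply/set0Pn; exists i; rewrite in_block.
rewrite in_block => /eqP f_iv ->; rewrite -[nth 0 w k]/(f i) f_iv.
by apply: w_le; rewrite inE sz_w.
Qed.

End Matchings.

(** * The forbidden patterns and the count *)

Local Notation i0 := (@Ordinal 3 0 isT).
Local Notation i1 := (@Ordinal 3 1 isT).
Local Notation i2 := (@Ordinal 3 2 isT).

Lemma one_lineE (p : 'S_3) : one_line p = [:: (p i0).+1; (p i1).+1; (p i2).+1].
Proof.
rewrite /one_line !enum_ordSl enum_ord0 /=.
by congr [:: (p _).+1; (p _).+1; (p _).+1]; apply: val_inj.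
Qed.

(** The arcs [Bs] are listed by opening and [v] is the pattern they form, with
    values starting at 0. *)
Lemma contains_P18_intro n (M : {set {set 'I_(2 * n)}})
    (Bs : seq {set 'I_(2 * n)}) (v : seq nat) :
  (forall i, i < 3 -> nth set0 Bs i \in M) ->
  (forall i j, i < j -> j < 3 ->
    opening (nth set0 Bs i) < opening (nth set0 Bs j)) ->
  (forall i j, i < 3 -> j < 3 ->
    opening (nth set0 Bs i) < closing (nth set0 Bs j)) ->
  (forall i j, i < 3 -> j < 3 ->
    (closing (nth set0 Bs i) < closing (nth set0 Bs j)) =
    (nth 0 v j < nth 0 v i)) ->
  v \in [:: [:: 1; 0; 2]; [:: 1; 2; 0]; [:: 2; 1; 0]] ->
  exists2 p, p \in P18 & contains M p.
Proof.
move=> Bs_in Bs_o Bs_oc Bs_c v_in.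
pose f (i : 'I_3) : 'I_3 := inord (nth 0 v i).
have f_val i : f i = nth 0 v i :> nat.
  rewrite /f inordK //; move: v_in; rewrite !inE.
  by case: i => [[|[|[|//]]] ?] /or3P[]/eqP->.
have f_inj : injective f.
  move=> i j /(congr1 val); rewrite /= !f_val => e; apply: val_inj => /=.
  move: e v_in; rewrite !inE.
  by case: i => [[|[|[|//]]] ?]; case: j => [[|[|[|//]]] ?] /= e /or3P[]/eqP ev;
    rewrite ev in e.
exists (perm f_inj).
  rewrite inE one_lineE !permE !f_val /=; move: v_in; rewrite !inE.
  by case/or3P=> /eqP->.
apply/existsP; exists [ffun i : 'I_3 => nth set0 Bs i]; apply/and4P; split.
- by apply/forallP=> i; rewrite ffunE Bs_in.
- by apply/forallP=> i; apply/forallP=> j; rewrite !ffunE; apply/implyP => lt;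
    apply: Bs_o.
- by apply/forallP=> i; apply/forallP=> j; rewrite !ffunE; apply: Bs_oc.
- by apply/forallP=> i; apply/forallP=> j; rewrite !ffunE !permE !f_val Bs_c.
Qed.

(** In a bad triple the opening of [X], the first arc to close, may lie before,
    between or after those of [Y] and [Z]; the pattern is accordingly 321, 231
    or 213. *)
Lemma avoids_P18P n (M : {set {set 'I_(2 * n)}}) : perfect_matching M ->
  avoids M P18 <-> forall X Y Z, ~ bad_triple M X Y Z.
Proof.
move=> M_pm; split=> [/forall_inP avM X Y Z [[XM YM ZM] [c1 c2 o2 oc]]|no_bad].
  suff [p /avM/negP pP cM] : exists2 p, p \in P18 & contains M p by [].
  have oX := opening_lt_closing M_pm XM.
  have neqY : opening X != opening Y.
    by apply: contraTneq c1 => /(opening_inj M_pm XM YM)->; rewrite ltnn.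
  have neqZ : opening X != opening Z.
    apply: contraTneq (ltn_trans c1 c2) => /(opening_inj M_pm XM ZM)->.
    by rewrite ltnn.
  have [lt_XY|le_YX] := ltnP (opening X) (opening Y).
    apply: (@contains_P18_intro n M [:: X; Y; Z] [:: 2; 1; 0]) 
      => [[|[|[|i]]]|[|[|[|i]]] [|[|[|j]]]|[|[|[|i]]] [|[|[|j]]]
         |[|[|[|i]]] [|[|[|j]]]|] //= *; lia.
  have [lt_XZ|le_ZX] := ltnP (opening X) (opening Z).
    apply: (@contains_P18_intro n M [:: Y; X; Z] [:: 1; 2; 0]) 
      => [[|[|[|i]]]|[|[|[|i]]] [|[|[|j]]]|[|[|[|i]]] [|[|[|j]]]
         |[|[|[|i]]] [|[|[|j]]]|] //= *; lia.
  apply: (@contains_P18_intro n M [:: Y; Z; X] [:: 1; 0; 2]) 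
      => [[|[|[|i]]]|[|[|[|i]]] [|[|[|j]]]|[|[|[|i]]] [|[|[|j]]]
         |[|[|[|i]]] [|[|[|j]]]|] //= *; lia.
apply/forall_inP=> p; rewrite inE one_lineE => p_in; apply/negP=> /existsP[B].
case/and4P=> /forallP B_in /forallP B_o /forallP B_oc /forallP B_c.
have B_lt i j : p j < p i -> closing (B i) < closing (B j).
  by have /forallP/(_ j)/eqP-> := B_c i.
have B_oo (i j : 'I_3) : i < j -> opening (B i) < opening (B j).
  by have /forallP/(_ j)/implyP := B_o i.
have B_ooc i j : opening (B i) < closing (B j) by have /forallP := B_oc i.
move: p_in; rewrite !inE => /or3P[]/eqP[p0 p1 p2].
- by apply: (no_bad (B i2) (B i0) (B i1)); split; split=> //;
    try apply: B_lt; rewrite ?p0 ?p1 ?p2 //; apply: B_oo.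
- by apply: (no_bad (B i1) (B i0) (B i2)); split; split=> //;
    try apply: B_lt; rewrite ?p0 ?p1 ?p2 //; apply: B_oo.
- by apply: (no_bad (B i0) (B i1) (B i2)); split; split=> //;
    try apply: B_lt; rewrite ?p0 ?p1 ?p2 //; apply: B_oo.
Qed.

Lemma card_avoiding_matchings n :
  #|avoiding_matchings n P18| = size (words (2 * n) [::]).
Proof.
rewrite cardE -(size_map (@word_of n)); apply/perm_size/uniq_perm.
- rewrite map_inj_in_uniq ?enum_uniq // => M M'.
  rewrite !mem_enum !inE => /andP[M_pm _] /andP[M'_pm _] eq_w.
  by rewrite -(preim_word_of M_pm) eq_w preim_word_of.
- exact: words_uniq.
move=> w; apply/mapP/idP => [[M]|/avoiding_matching_words[sz_w w_m w_av]].
  rewrite mem_enum inE => /andP[M_pm M_av] ->; apply/avoiding_matching_words.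
  split; [exact: size_word_of | exact: matching_word_of |].
  exact/avoiding_word_of/avoids_P18P.
have [M M_pm def_w] := matching_of_word sz_w w_m; exists M => //.
rewrite mem_enum inE M_pm; apply/avoids_P18P => //.
by apply/avoiding_word_of; rewrite // def_w.
Qed.

Theorem theorem28 (n : nat) (hn : 1 <= n) :
  (#|avoiding_matchings n P18|%:R =
     (3 * n + 1)%N%:R^-1 * 'C(3 * n + 1, n)%:R :> rat)%R.
Proof.
rewrite card_avoiding_matchings -size_words_start GRing.natrM GRing.mulKf //.
by rewrite Num.Theory.pnatr_eq0 addn1.
Qed.
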